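(* Let $0<\varepsilon\le1/3$, $\lambda=(1-\varepsilon)/2$, and $P_\theta=\{0,\theta,1\}$ with $1/2\le\theta<1$. Then $$G_{P_\theta}(C_\varepsilon)\subseteq\bigcup_{n\ge0}\lambda^n\left[\frac{\varepsilon}{\theta},\,U_\theta(\varepsilon)\right],\qquad U_\theta(\varepsilon):=\min\left\{1,\frac{\lambda}{1-\theta}\right\}.$$ If $\lambda U_\theta(\varepsilon)<\varepsilon/\theta$, then $G_{P_\theta}(C_\varepsilon)$ contains no interval of the form $(0,r)$ with $r>0$. For $0<\theta<1/2$, the same conclusions hold for $G_{P_\theta}(C_\varepsilon)$ with $\theta$ replaced by $1-\theta$ in the containing intervals and in the criterion.
   Context: The middle-$\varepsilon$ Cantor set $C_\varepsilon\subset[0,1]$ is the attractor of $f_0(x)=\lambda x$ and $f_1(x)=1-\lambda+\lambda x$ with $\lambda=(1-\varepsilon)/2$, i.e. the unique nonempty compact set with $C_\varepsilon=f_0(C_\varepsilon)\cup f_1(C_\varepsilon)$. For a finite set $P\subset[0,1]$ and compact $C\subset\mathbb R$, $G_P(C):=\{s>0:\exists x\in\mathbb R\text{ with }x+sP\subset C\}$. $[L,U]$ is understood to be empty if $L>U$. *)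

(* Defs.v *)
From HB Require Import structures.
From mathcomp Require Import all_boot all_order all_algebra.
From mathcomp Require Import all_classical all_reals all_analysis.
From mathcomp Require Import ring lra.
Set Implicit Arguments.
Unset Strict Implicit.
Unset Printing Implicit Defensive.
Import Order.TTheory GRing.Theory Num.Theory.
Import numFieldNormedType.Exports.
Local Open Scope classical_set_scope.
Local Open Scope ring_scope.

Definition cantor_ratio (R : realType) (eps : R) : R := (1 - eps) / 2.

Definition cantor_f0 (R : realType) (eps x : R) : R := cantor_ratio eps * x.

Definition cantor_f1 (R : realType) (eps x : R) : R :=
  1 - cantor_ratio eps + cantor_ratio eps * x.

Definition is_attractor (R : realType) (f0 f1 : R -> R) (C : set R) : Prop :=
  [/\ C !=set0, compact C & C = (f0 @` C) `|` (f1 @` C)].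

(* The default set0 is never used when 0 < eps < 1: see [middle_cantorP] and
   [middle_cantor_unique]. *)
Definition middle_cantor (R : realType) (eps : R) : set R :=
  xget set0 [set C | is_attractor (cantor_f0 eps) (cantor_f1 eps) C].

(* G_P(C): the scales of the homothetic copies of P contained in C. *)
Definition copy_scales (R : realType) (P C : set R) : set R :=
  [set s | 0 < s /\ exists x : R, [set x + s * p | p in P] `<=` C].

Definition three_point_pattern (R : realType) (theta : R) : set R :=
  [set 0; theta; 1].

Definition scale_upper (R : realType) (theta eps : R) : R :=
  Num.min 1 (cantor_ratio eps / (1 - theta)).

Definition scale_bands (R : realType) (theta eps : R) : set R :=
  \bigcup_(n in [set: nat])
    [set cantor_ratio eps ^+ n * t | t in `[eps / theta, scale_upper theta eps]].

Section attractor.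
Variables (R : realType) (eps : R).
Hypotheses (eps0 : 0 < eps) (eps1 : eps < 1).
Let lam := cantor_ratio eps.
Let F (A : set R) := (cantor_f0 eps @` A) `|` (cantor_f1 eps @` A).

Let lam0 : 0 < lam.
Proof. by rewrite /lam /cantor_ratio; move: eps1; lra. Qed.

Let lam1 : lam < 1.
Proof. by rewrite /lam /cantor_ratio; move: eps0; lra. Qed.

Let F_sub (A B : set R) : A `<=` B -> F A `<=` F B.
Proof.
by move=> AB x [[y /AB By <-]|[y /AB By <-]]; [left|right]; exists y.
Qed.

Let F_unit : F `[0, 1] `<=` `[0, 1].
Proof.
move: lam0 lam1 => l0 l1 x [] [y /=]; rewrite in_itv/= => /andP[y0 y1] <- /=;
  rewrite in_itv/= /cantor_f0 /cantor_f1 -/lam.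
  have p0 : 0 <= lam * y; first by rewrite mulr_ge0 // ltW.
  have p1 : lam * y <= lam; first by rewrite ger_pMr.
  by apply/andP; split; lra.
have p0 : 0 <= lam * y; first by rewrite mulr_ge0 // ltW.
have p1 : lam * y <= lam; first by rewrite ger_pMr.
by apply/andP; split; lra.
Qed.

Let f0_cts : continuous (cantor_f0 eps).
Proof. by move=> x; apply: cvgM; [exact: cvg_cst|exact: cvg_id]. Qed.

Let f1_cts : continuous (cantor_f1 eps).
Proof.
by move=> x; apply: cvgD; [exact: cvg_cst|apply: cvgM; [exact: cvg_cst|exact: cvg_id]].
Qed.

Let F_compact (A : set R) : compact A -> compact (F A).
Proof.
move=> cA; apply: compactU; apply: continuous_compact => //;
  exact: continuous_subspaceT.
Qed.

Lemma attractor_exists :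
  exists C, is_attractor (cantor_f0 eps) (cantor_f1 eps) C.
Proof.
pose C := \bigcup_(A in [set A : set R | A `<=` `[0, 1] /\ A `<=` F A]) A.
have Cmax A : A `<=` `[0, 1] -> A `<=` F A -> A `<=` C.
  by move=> A1 A2 x Ax; exists A.
have C01 : C `<=` `[0, 1] by move=> x [A [A01 _] /A01].
have CF : C `<=` F C.
  by move=> x [A [A1 A2] /A2]; apply: F_sub; exact: Cmax.
have clC01 : closure C `<=` `[0, 1].
  rewrite [X in _ `<=` X](closure_id _).1; last exact: itv_closed.
  exact: closureS.
have cclC : compact (closure C).
  by apply: (subclosed_compact _ (@segment_compact R 0 1) clC01); exact: closed_closure.
have clCF : closure C `<=` F (closure C).
  rewrite [X in _ `<=` X](closure_id _).1.
    apply: closureS; apply: (subset_trans CF); apply: F_sub.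
    exact: subset_closure.
  by apply: compact_closed; [exact: Rhausdorff|exact: F_compact].
have CE : C = closure C.
  by apply/seteqP; split; [exact: subset_closure|exact: Cmax].
exists C; split; last 1 first.
- apply/seteqP; split=> //; apply: Cmax; last exact: F_sub.
  by apply: subset_trans F_unit; exact: F_sub.
- exists 0; apply: (Cmax [set 0]) => // x -> /=.
  + by rewrite in_itv/= lexx ler01.
  + by left; exists 0 => //; rewrite /cantor_f0 mulr0.
- by rewrite CE.
Qed.

Let attractor_sub (C D : set R) :
  is_attractor (cantor_f0 eps) (cantor_f1 eps) C ->
  is_attractor (cantor_f0 eps) (cantor_f1 eps) D -> C `<=` D.
Proof.
move=> [_ cC CE] [[d Dd] cD DE].
have [M [Mreal MC]] := compact_bounded cC.
pose K : R := `|M| + 1 + `|d|.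
have near n x : C x -> exists2 y, D y & `|x - y| <= lam ^+ n * K.
  elim: n x => [|n IHn] x Cx.
    exists d => //; rewrite expr0 mul1r; apply: (le_trans (ler_normB _ _)).
    by rewrite lerD2r; apply: MC => //; have := ler_norm M; lra.
  move: Cx; rewrite CE => -[] [u Cu <-]; have [v Dv uv] := IHn u Cu.
  - exists (cantor_f0 eps v); first by rewrite DE; left; exists v.
    rewrite /cantor_f0 -/lam -mulrBr normrM (gtr0_norm lam0) exprS -mulrA.
    by rewrite ler_pM2l.
  - exists (cantor_f1 eps v); first by rewrite DE; right; exists v.
    rewrite /cantor_f1 -/lam opprD addrACA subrr add0r -mulrBr normrM.
    by rewrite (gtr0_norm lam0) exprS -mulrA ler_pM2l.
move=> x Cx; have cD' : closed D by apply: compact_closed => //; exact: Rhausdorff.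
rewrite [D](closure_id _).1//; move=> B /nbhs_ballP[e /= e0 eB].
have lamK : (fun n => lam ^+ n * K) @ \oo --> (0 : R).
  rewrite -[X in _ --> X](mul0r K); apply: cvgM; last exact: cvg_cst.
  by apply: cvg_expr; rewrite gtr0_norm.
move/cvgrPdist_lt: lamK => /(_ e e0)[N _ /(_ N (leqnn N)) /=].
rewrite sub0r normrN => lt_e; have [y Dy xy] := near N x Cx.
exists y; split=> //; apply: eB; rewrite /ball /=.
exact: le_lt_trans xy (le_lt_trans (ler_norm _) lt_e).
Qed.

Lemma middle_cantorP :
  is_attractor (cantor_f0 eps) (cantor_f1 eps) (middle_cantor eps).
Proof. by apply: xgetPex; exact: attractor_exists. Qed.

Lemma middle_cantor_unique (C : set R) :
  is_attractor (cantor_f0 eps) (cantor_f1 eps) C -> C = middle_cantor eps.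
Proof.
by move=> aC; apply/seteqP; split; apply: attractor_sub => //;
  exact: middle_cantorP.
Qed.

End attractor.

(* Main.v *)
(* Let C = C_eps. If a copy of {0, theta, 1} of scale s lies in one half f_i(C),
   then s / lambda is again an admissible scale. Otherwise the copy jumps the
   central gap of length eps, which forces eps <= s tau and s (1 - tau) <= lambda
   with tau = max(theta, 1 - theta), that is, s lies in the band n = 0. Since
   scales are at most 1, the rescaling stops after finitely many steps. If the
   bands are separated, a scale c with lambda U < c < eps / tau, and hence every
   lambda^n c, lies in no band. *)
Require Import Defs.
From HB Require Import structures.
From mathcomp Require Import all_boot all_order all_algebra.
From mathcomp Require Import all_classical all_reals all_analysis.
From mathcomp Require Import ring lra.
Set Implicit Arguments.
Unset Strict Implicit.
Unset Printing Implicit Defensive.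
Import Order.TTheory GRing.Theory Num.Theory.
Import numFieldNormedType.Exports.
Local Open Scope classical_set_scope.
Local Open Scope ring_scope.

Lemma exists_expr_lt (R : realType) (l e : R) :
  0 < l -> l < 1 -> 0 < e -> exists n, l ^+ n < e.
Proof.
move=> l0 l1 e0.
have : (fun n => l ^+ n) @ \oo --> (0 : R) by apply: cvg_expr; rewrite gtr0_norm.
move/cvgrPdist_lt => /(_ e e0)[N _ /(_ N (leqnn N)) /=].
by rewrite sub0r normrN gtr0_norm ?exprn_gt0 //; exists N.
Qed.

Section middle_cantor.
Variables (R : realType) (eps : R).
Hypotheses (eps0 : 0 < eps) (eps1 : eps < 1).
Let lam := cantor_ratio eps.
Let C := middle_cantor eps.

Let lam0 : 0 < lam.
Proof. by rewrite /lam /cantor_ratio; move: eps1; lra. Qed.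

Let lam1 : lam < 1.
Proof. by rewrite /lam /cantor_ratio; move: eps0; lra. Qed.

Let eps_lam : eps = 1 - 2 * lam.
Proof. by rewrite /lam /cantor_ratio; lra. Qed.

Lemma middle_cantor_split (x : R) : C x ->
  (exists2 u, C u & x = lam * u) \/ (exists2 u, C u & x = 1 - lam + lam * u).
Proof.
have [_ _ CE] := middle_cantorP eps0 eps1.
by rewrite {1}/C {1}CE => -[[u Cu <-]|[u Cu <-]]; [left|right]; exists u.
Qed.

(** Compactness bounds [C] somehow; self-similarity then shrinks any excess beyond the unit interval
    by the factor [lam] at each level, so the excess is below every positive number. *)
Lemma middle_cantor_unit (x : R) : C x -> 0 <= x <= 1.
Proof.
have [_ cC _] := middle_cantorP eps0 eps1.
have [M [Mreal MC]] := compact_bounded cC.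
(* [compact_bounded] yields a bound only for numbers strictly above [M]; adding 1 ensures this and
   makes [K] positive. *)
pose K : R := `|M| + 1.
have K0 : 0 < K by rewrite /K ltr_wpDl.
have bnd n y : C y -> - (lam ^+ n * K) <= y <= 1 + lam ^+ n * K.
  elim: n y => [|n IHn] y Cy.
    have : `|y| <= K by apply: MC => //; have := ler_norm M; rewrite /K; lra.
    by rewrite ler_norml expr0; lra.
  have p0 : 0 <= lam ^+ n * K by rewrite mulr_ge0 ?exprn_ge0 // ltW.
  move: p0; rewrite exprS -mulrA; set p := _ ^+ n * K => p0.
  case: (middle_cantor_split Cy) => -[u /IHn]; rewrite -/p => ub ->;
    move: lam0 lam1; clearbody lam p; nra.
move=> Cx; apply/andP; split; rewrite leNgt; apply/negP => xlt.
- have [n] : exists n, lam ^+ n < - x / K.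
    by apply: exists_expr_lt => //; rewrite divr_gt0 // oppr_gt0.
  by rewrite ltr_pdivlMr // => ?; have /andP[] := bnd n x Cx; lra.
- have [n] : exists n, lam ^+ n < (x - 1) / K.
    by apply: exists_expr_lt => //; rewrite divr_gt0 // subr_gt0.
  by rewrite ltr_pdivlMr // => ?; have /andP[] := bnd n x Cx; lra.
Qed.

Lemma three_point_copyP (P : set R) (theta s x : R) :
  [set x + s * p | p in three_point_pattern theta] `<=` P <->
  [/\ P x, P (x + s * theta) & P (x + s)].
Proof.
split=> [sub|[P0 Pt P1] _ [p [[|]->|->] <-]].
- split; apply: sub.
  + by exists 0; [left; left|rewrite mulr0 addr0].
  + by exists theta => //; left; right.
  + by exists 1; [right|rewrite mulr1].
- by rewrite mulr0 addr0.
- by [].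
- by rewrite mulr1.
Qed.

Section scales.
(** [tau] stands for the larger of [theta] and [1 - theta]. Using it only as a common upper bound
    treats both ranges of [theta] at once, without reflecting [C]. *)
Variables theta tau : R.
Hypotheses (theta0 : 0 < theta) (theta1 : theta < 1).
Hypotheses (theta_tau : theta <= tau) (theta_tau' : 1 - theta <= tau).
Hypothesis tau1 : tau < 1.
Let G := copy_scales (three_point_pattern theta) C.

Let tau0 : 0 < tau. Proof. exact: lt_le_trans theta0 theta_tau. Qed.

Lemma copy_scale_le1 s : G s -> s <= 1.
Proof.
move=> [s0 [x /three_point_copyP[Cx _ Cxs]]].
by have := middle_cantor_unit Cx; have := middle_cantor_unit Cxs; lra.
Qed.

Lemma copy_scale_step s : G s ->
  s \in `[eps / tau, scale_upper tau eps] \/ G (s / lam).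
Proof.
move=> Gs; have s1 := copy_scale_le1 Gs.
case: Gs => s0 [x /three_point_copyP[Cx Cxt Cxs]].
have st0 : 0 < s * theta by rewrite mulr_gt0.
have st1 : s * theta < s by rewrite gtr_pMr.
have band : eps <= s * tau -> s * (1 - tau) <= lam ->
    s \in `[eps / tau, scale_upper tau eps].
  move=> h1 h2; rewrite in_itv /= ler_pdivrMr // h1 /scale_upper le_min s1 /=.
  by rewrite ler_pdivlMr // subr_gt0.
have lamK u : lam * u / lam = u by rewrite mulrC mulKf // gt_eqF.
(* The preimages [u], [v], [w] under a common branch form the enlarged copy, based at [u]. *)
have rescale u v w : C u -> C v -> C w ->
    s * theta = lam * (v - u) -> s = lam * (w - u) -> G (s / lam).
  move=> Cu Cv Cw hv hw; split; first by rewrite divr_gt0.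
  exists u; apply/three_point_copyP; split=> //.
    by rewrite mulrAC hv lamK subrKC.
  by rewrite hw lamK subrKC.
have sub_lam u : C u -> 0 <= lam * u <= lam.
  move=> /middle_cantor_unit/andP[u0 u1].
  by rewrite mulr_ge0 ?ger_pMr // ltW.
have [epsE epsgt0] := (eps_lam, eps0).
have sD : s * theta <= s * tau by rewrite ler_pM2l.
have sD' : s * (1 - theta) <= s * tau by rewrite ler_pM2l.
(* Eight placements of the three points in the two halves. Only the monotone ones survive. If the
   jump is on one side of the middle point, that side has length at least [eps] and at most
   [s * tau]; the other has length at most [lam] and at least [s * (1 - tau)]. *)
case: (middle_cantor_split Cx) => -[u Cu hu];
case: (middle_cantor_split Cxt) => -[v Cv hv];
case: (middle_cantor_split Cxs) => -[w Cw hw];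
have := sub_lam _ Cu; have := sub_lam _ Cv; have := sub_lam _ Cw => bw bv bu.
- by right; apply: (rescale u v w) => //; rewrite mulrBr; lra.
- by left; apply: band; lra.
- by exfalso; lra.
- by left; apply: band; lra.
- by exfalso; lra.
- by exfalso; lra.
- by exfalso; lra.
- by right; apply: (rescale u v w) => //; rewrite mulrBr; lra.
Qed.

Lemma copy_scales_sub_bands : G `<=` scale_bands tau eps.
Proof.
move=> s Gs; have [n] := exists_expr_lt lam0 lam1 Gs.1.
(* Induction on [n] with [lam ^+ n < s]: passing to [s / lam] lowers [n] by one, and [n = 0] would
   give [s > 1]. *)
elim: n s Gs => [|n IHn] s Gs lt_s.
  by have := copy_scale_le1 Gs; rewrite leNgt lt_s.
case: (copy_scale_step Gs) => [sI|/IHn[|m _ [t tI tE]]].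
- by exists 0%N => //; exists s => //; rewrite expr0 mul1r.
- by rewrite ltr_pdivlMr // -exprSr.
- exists m.+1 => //; exists t => //.
  by rewrite exprS -mulrA tE mulrC divfK // gt_eqF.
Qed.

Lemma copy_scales_no_interval :
  lam * scale_upper tau eps < eps / tau ->
  ~ exists2 r : R, 0 < r & `]0, r[ `<=` G.
Proof.
set U := scale_upper tau eps => gap [r r0 sub].
have U0 : 0 < U by rewrite lt_min ltr01 divr_gt0 // subr_gt0.
have [c lc ct] : exists2 c, lam * U < c & c < eps / tau.
  by exists ((lam * U + eps / tau) / 2); lra.
have c0 : 0 < c by apply: lt_trans lc; rewrite mulr_gt0.
have [n] : exists n, lam ^+ n < r / c.
  by apply: exists_expr_lt => //; rewrite divr_gt0.
rewrite ltr_pdivlMr // => ltr.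
have ln k : 0 < lam ^+ k by rewrite exprn_gt0.
have /sub/copy_scales_sub_bands[m _ [t]] : `]0, r[%classic (lam ^+ n * c).
  by rewrite /= in_itv /= mulr_gt0.
rewrite /= in_itv /= -/lam -/U => /andP[t0 t1]; apply/eqP.
have tpos : 0 < t by apply: lt_le_trans t0; rewrite divr_gt0.
(* A band of index [m <= n] lies above [lam ^+ n * c] because [c < eps / tau]; one of index at least
   [n.+1] lies below it because [lam * U < c]. *)
have [mn|nm] := leqP m n.
- rewrite gt_eqF //; apply: (@lt_le_trans _ _ (lam ^+ n * t)).
    by rewrite ltr_pM2l //; lra.
  by rewrite ler_pM2r // ler_wiXn2l // ltW.
- rewrite lt_eqF //; apply: (@le_lt_trans _ _ (lam ^+ n.+1 * U)).
    apply: ler_pM => //; try exact: ltW.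
    by rewrite ler_wiXn2l // ltW.
  by rewrite exprSr -mulrA ltr_pM2l.
Qed.

End scales.
End middle_cantor.

Theorem corollary3p5 (R : realType) (eps theta : R)
    (heps0 : 0 < eps) (heps : eps <= 1 / 3) :
  (1 / 2 <= theta -> theta < 1 ->
     copy_scales (three_point_pattern theta) (middle_cantor eps)
       `<=` scale_bands theta eps
     /\ (cantor_ratio eps * scale_upper theta eps < eps / theta ->
         ~ exists2 r : R, 0 < r &
             `]0, r[ `<=` copy_scales (three_point_pattern theta)
                            (middle_cantor eps)))
  /\
  (0 < theta -> theta < 1 / 2 ->
     copy_scales (three_point_pattern theta) (middle_cantor eps)
       `<=` scale_bands (1 - theta) eps
     /\ (cantor_ratio eps * scale_upper (1 - theta) eps < eps / (1 - theta) ->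
         ~ exists2 r : R, 0 < r &
             `]0, r[ `<=` copy_scales (three_point_pattern theta)
                            (middle_cantor eps))).
Proof.
have eps1 : eps < 1 by lra.
split=> h0 h1; split.
- by apply: copy_scales_sub_bands => //; lra.
- by apply: copy_scales_no_interval => //; lra.
- by apply: copy_scales_sub_bands => //; lra.
- by apply: copy_scales_no_interval => //; lra.
Qed.
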